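(* Let $E$ be an Archimedean homogeneous effect algebra fulfilling the condition (W+). Then $E$ can be covered by Archimedean MV-algebras which form blocks; that is, $E$ is the union of its blocks, and every block of $E$ is lattice ordered and is an Archimedean MV-algebra.
   Context: An effect algebra is a partial algebra $(E;\oplus,0,1)$ with $0\neq 1$ and a partial binary operation $\oplus$ such that for all $x,y,z\in E$: (1) $x\oplus y=y\oplus x$ if $x\oplus y$ is defined; (2) $(x\oplus y)\oplus z=x\oplus(y\oplus z)$ if one side is defined; (3) for every $x$ there is a unique $y$ (denoted $x'$) with $x\oplus y=1$; (4) if $1\oplus x$ is defined then $x=0$. One writes $x\le y$ and $y\ominus x=z$ iff $x\oplus z$ is defined and equals $y$; $\le$ is a partial order. A sub-effect algebra of $E$ is a subset $Q\subseteq E$ with $1\in Q$ such that whenever $x\oplus y=z$ in $E$ and two of $x,y,z$ lie in $Q$, all three lie in $Q$; it is an effect algebra with the inherited operation. $E$ satisfies the Riesz decomposition property if $u\le v_1\oplus v_2$ implies $u=u_1\oplus u_2$ for some $u_1\le v_1$, $u_2\le v_2$. $E$ is homogeneous if $u\le v_1\oplus v_2\le u'$ implies $u=u_1\oplus u_2$ for some $u_1\le v_1$, $u_2\le v_2$. A block of a homogeneous effect algebra $E$ is a maximal sub-effect algebra of $E$ with the Riesz decomposition property. $E$ is Archimedean if for every nonzero $x\in E$ there is a greatest positive integer $n$ such that $nx=x\oplus\dots\oplus x$ ($n$ times) exists. A subset $A\subseteq E$ is orthogonal if the sum $\bigoplus K$ exists for every finite $K\subseteq A$ (with $\bigoplus\emptyset=0$),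 and then $A^\oplus=\{\bigoplus K\mid K\subseteq A \text{ finite}\}$. $E$ fulfills the condition (W+) if for each orthogonal subset $A\subseteq E$ and each two upper bounds $u,v$ of $A^\oplus$ there exists an upper bound $w$ of $A^\oplus$ with $w\le u$ and $w\le v$. An effect algebra is said to be an MV-algebra (an MV-effect algebra) if it is lattice ordered and has the Riesz decomposition property; it is then an MV-algebra under the total operation $x\boxplus y=x\oplus(x'\wedge y)$ and negation $x\mapsto x'$. It is called Archimedean if it is Archimedean as an effect algebra. *)

(* Defs.v *)
From Stdlib Require Import List.
From mathcomp Require Import all_boot.
From mathcomp Require Import boolp classical_sets.

Set Implicit Arguments.
Unset Strict Implicit.
Unset Printing Implicit Defensive.

Local Open Scope classical_set_scope.

(* The partial operation is option-valued: [oplus x y = None] means that the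
   sum is undefined.  Hence the two equations between options below say
   "if one side is defined, then so is the other and they are equal". *)
Record effectAlgebra : Type := EffectAlgebra {
  ea_sort :> Type;
  oplus : ea_sort -> ea_sort -> option ea_sort;
  ea_zero : ea_sort;
  ea_one : ea_sort;
  ea_zero_neq_one : ea_zero <> ea_one;
  oplusC : forall x y, oplus x y = oplus y x;
  oplusA : forall x y z,
    obind (fun s => oplus s z) (oplus x y) =
    obind (fun t => oplus x t) (oplus y z);
  ea_orthosupplement : forall x, exists! y, oplus x y = Some ea_one;
  ea_zero_one_law : forall x, oplus ea_one x <> None -> x = ea_zero
}.

Arguments oplus {e}.
Arguments ea_zero {e}.
Arguments ea_one {e}.

Section Basics.
Variable E : effectAlgebra.
Implicit Types (x y z u v : E) (A : set E).

Definition orthosupp x : E := sval (cid (ea_orthosupplement x)).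

Lemma orthosuppP x y : oplus x y = Some ea_one <-> y = orthosupp x.
Proof.
rewrite /orthosupp; case: cid => /= z [xz zuniq]; split=> [xy|-> //].
exact/esym/zuniq.
Qed.

Definition ea_le x y : Prop := exists z, oplus x z = Some y.

Definition oplus_seq (s : seq E) : option E :=
  foldr (fun x o => obind (oplus x) o) (Some ea_zero) s.

Definition ntimes (n : nat) x : option E := oplus_seq (nseq n x).

Definition archimedean : Prop :=
  forall x, x <> ea_zero ->
    exists n : nat, [/\ 0 < n, ntimes n x <> None &
      forall m : nat, 0 < m -> ntimes m x <> None -> m <= n].

Definition riesz_decomposition : Prop :=
  forall u v1 v2 v, oplus v1 v2 = Some v -> ea_le u v ->
    exists u1 u2, [/\ ea_le u1 v1, ea_le u2 v2 & oplus u1 u2 = Some u].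

Definition homogeneous : Prop :=
  forall u v1 v2 v, oplus v1 v2 = Some v ->
    ea_le u v -> ea_le v (orthosupp u) ->
    exists u1 u2, [/\ ea_le u1 v1, ea_le u2 v2 & oplus u1 u2 = Some u].

(* A finite subset [K] of [A] is given by a duplicate-free enumeration [s];
   the order of enumeration is irrelevant by [oplusC] and [oplusA]. *)
Definition enum_finite_subset A (s : seq E) : Prop :=
  NoDup s /\ forall x, In x s -> A x.

Definition orthogonal A : Prop :=
  forall s, enum_finite_subset A s -> oplus_seq s <> None.

Definition finite_sums A : set E :=
  [set z | exists s, enum_finite_subset A s /\ oplus_seq s = Some z].

Definition upper_bound A u : Prop := forall x, A x -> ea_le x u.

Definition lower_bound A u : Prop := forall x, A x -> ea_le u x.

Definition condition_Wplus : Prop :=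
  forall A, orthogonal A -> forall u v,
    upper_bound (finite_sums A) u -> upper_bound (finite_sums A) v ->
    exists w, [/\ upper_bound (finite_sums A) w, ea_le w u & ea_le w v].

Definition is_join x y z : Prop :=
  upper_bound [set x; y] z /\ forall u, upper_bound [set x; y] u -> ea_le z u.

Definition is_meet x y z : Prop :=
  lower_bound [set x; y] z /\ forall u, lower_bound [set x; y] u -> ea_le u z.

Definition lattice_ordered : Prop :=
  forall x y, (exists z, is_join x y z) /\ (exists z, is_meet x y z).

Definition MV_effect_algebra : Prop :=
  lattice_ordered /\ riesz_decomposition.

End Basics.

Arguments archimedean : clear implicits.
Arguments riesz_decomposition : clear implicits.
Arguments homogeneous : clear implicits.
Arguments condition_Wplus : clear implicits.
Arguments lattice_ordered : clear implicits.
Arguments MV_effect_algebra : clear implicits.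

Record subEffectAlgebra (E : effectAlgebra) : Type := SubEffectAlgebra {
  sub_carrier :> set E;
  sub_one : sub_carrier ea_one;
  sub_closed : forall x y z : E, oplus x y = Some z ->
    [/\ sub_carrier x -> sub_carrier y -> sub_carrier z,
        sub_carrier x -> sub_carrier z -> sub_carrier y &
        sub_carrier y -> sub_carrier z -> sub_carrier x]
}.

Section InheritedStructure.
Variables (E : effectAlgebra) (Q : subEffectAlgebra E).

Definition sub_sort : Type := {x : E | sub_carrier Q x}.

Lemma sub_sort_inj (x y : sub_sort) : sval x = sval y -> x = y.
Proof. by case: x y => [x Qx] [y Qy] /= e; apply: eq_exist. Qed.

Lemma oplus_sub (x y : sub_sort) z :
  oplus (sval x) (sval y) = Some z -> sub_carrier Q z.
Proof. by move=> /(sub_closed Q) [+ _ _]; apply; apply: svalP. Qed.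

Definition sub_oplus (x y : sub_sort) : option sub_sort :=
  match oplus (sval x) (sval y) as o
    return oplus (sval x) (sval y) = o -> option sub_sort with
  | Some z => fun e => Some (exist (sub_carrier Q) z (oplus_sub e))
  | None => fun=> None
  end erefl.

Lemma sub_oplusE (x y : sub_sort) :
  omap sval (sub_oplus x y) = oplus (sval x) (sval y).
Proof.
rewrite /sub_oplus; move: (@oplus_sub x y).
by case: (oplus (sval x) (sval y)).
Qed.

Lemma omap_sval_inj : injective (omap (sval : sub_sort -> E)).
Proof. by case=> [x|] [y|] //= [/sub_sort_inj ->]. Qed.

Lemma sub_oplus_some (x y z : sub_sort) :
  sub_oplus x y = Some z <-> oplus (sval x) (sval y) = Some (sval z).
Proof.
by rewrite -sub_oplusE; split=> [-> //|e]; apply: omap_sval_inj.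
Qed.

Lemma oplus_zero_one : oplus ea_zero ea_one = Some (ea_one : E).
Proof.
have [z [oz _]] := ea_orthosupplement (ea_one : E).
by rewrite oplusC -(ea_zero_one_law (x := z)) ?oz.
Qed.

Lemma sub_zero_subproof : sub_carrier Q ea_zero.
Proof. by have [_ _] := sub_closed Q oplus_zero_one; apply; apply: sub_one. Qed.

Definition sub_ea_zero : sub_sort := exist (sub_carrier Q) _ sub_zero_subproof.
Definition sub_ea_one : sub_sort := exist (sub_carrier Q) _ (sub_one Q).

Lemma sub_zero_neq_one : sub_ea_zero <> sub_ea_one.
Proof. by move=> [] /ea_zero_neq_one. Qed.

Lemma sub_oplusC x y : sub_oplus x y = sub_oplus y x.
Proof. by apply: omap_sval_inj; rewrite !sub_oplusE oplusC. Qed.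

Lemma sub_oplusA x y z :
  obind (fun s => sub_oplus s z) (sub_oplus x y) =
  obind (fun t => sub_oplus x t) (sub_oplus y z).
Proof.
apply: omap_sval_inj.
transitivity (obind (fun s => oplus s (sval z)) (oplus (sval x) (sval y))).
  by rewrite -sub_oplusE; case: (sub_oplus x y) => //= s; rewrite sub_oplusE.
rewrite oplusA -sub_oplusE.
by case: (sub_oplus y z) => //= t; rewrite sub_oplusE.
Qed.

Lemma sub_orthosupplement x : exists! y, sub_oplus x y = Some sub_ea_one.
Proof.
have [y [xy yuniq]] := ea_orthosupplement (sval x).
have Qy : sub_carrier Q y.
  by have [_ + _] := sub_closed Q xy; apply; [apply: svalP|apply: sub_one].
exists (exist (sub_carrier Q) y Qy); split; first exact/sub_oplus_some.
by move=> z /sub_oplus_some xz; apply: sub_sort_inj; apply: yuniq.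
Qed.

Lemma sub_zero_one_law x : sub_oplus sub_ea_one x <> None -> x = sub_ea_zero.
Proof.
move=> H; apply: sub_sort_inj; apply: ea_zero_one_law.
rewrite -[ea_one]/(sval sub_ea_one) -sub_oplusE.
by case: (sub_oplus sub_ea_one x) H.
Qed.

Definition sub_effectAlgebra : effectAlgebra :=
  EffectAlgebra sub_zero_neq_one sub_oplusC sub_oplusA sub_orthosupplement
    sub_zero_one_law.

End InheritedStructure.

Definition block (E : effectAlgebra) (B : subEffectAlgebra E) : Prop :=
  riesz_decomposition (sub_effectAlgebra B) /\
  forall Q : subEffectAlgebra E, riesz_decomposition (sub_effectAlgebra Q) ->
    B `<=` Q -> Q = B :> set E.

(* Main.v *)
(* A sub-effect algebra with the Riesz decomposition property is the set of
   subsums of a family of finite decompositions of 1, directed under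
   refinement.  In a homogeneous effect algebra such a family stays directed
   after adding every decomposition in which each summand p is replaced by c, e
   with c + e = p and c + p defined; once the family is closed under these
   splittings, its subsums form a sub-effect algebra with the Riesz
   decomposition property.  Starting from {x, x'} and enlarging by Zorn's lemma
   puts x in a block; starting from all decompositions inside a block B shows
   that B contains every b such that b <= x <= b' for some x in B.

   For x, y in a block B write x = c + a and y = c + b with a + b defined.  All
   common lower bounds of a and b lie in B by the previous remark.  If they have
   a maximal element w, then c + w is the meet of x and y in B, by Riesz
   interpolation.  To find w, take a maximal set A of common lower bounds, all
   of whose finite sums are again common lower bounds, containing for each atom
   p the largest multiple of p below a and b.  (W+) gives an upper bound w <= a, b
   of the finite sums of A.  If w + z <= a, b with z nonzero, then [0, z] is
   contained in A by maximality, and there is no atom below z; hence A contains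
   infinitely many elements above a common nonzero one, and the existence of
   their finite sums contradicts the Archimedean property. *)

From HB Require Import structures.
Require Import Defs.
From Stdlib Require List.
From mathcomp Require Import boolp classical_sets.
From mathcomp Require Import all_boot ssralg.

Set Implicit Arguments.
Unset Strict Implicit.
Unset Printing Implicit Defensive.

Import GRing.Theory.

(* With [None] absorbing, the partial sum becomes a total commutative monoid law
   on [option E]: [isSome (a + b)] says that [a + b] is defined, [None] is on
   top of the order [<~], and [b <= a'] reads [isSome (b + a)]. *)
Definition pelt (E : effectAlgebra) : Type := option E.

(** * The partial sum as a commutative monoid law *)

Section TotalSum.
Variable E : effectAlgebra.
Implicit Types a b c d : pelt E.

HB.instance Definition _ := gen_eqMixin (pelt E).
HB.instance Definition _ := gen_choiceMixin (pelt E).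

Definition padd a b : pelt E := obind (fun x => obind (oplus x) b) a.

Lemma paddC : commutative padd.
Proof. by case=> [x|] [y|] //=; rewrite oplusC. Qed.

Lemma paddA : associative padd.
Proof.
by case=> [x|] [y|] [z|] //=; [rewrite -oplusA|case: (oplus x y)].
Qed.

Lemma padd_cancel_one a b c :
  padd a b = Some ea_one -> padd a c = Some ea_one -> b = c.
Proof.
case: a b c => [x|] [y|] [z|] //=.
by move=> /orthosuppP -> /orthosuppP ->.
Qed.

Lemma padd_compl a : isSome a -> exists b, padd a b = Some ea_one.
Proof.
by case: a => // x _; have [y [xy _]] := ea_orthosupplement x; exists (Some y).
Qed.

Lemma padd0 : left_id (Some ea_zero) padd.
Proof.
case=> [x|] //.
have [y xy] := @padd_compl (Some x) isT.
apply: (@padd_cancel_one y); last by rewrite paddC.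
by rewrite paddC -paddA xy; exact: oplus_zero_one.
Qed.

HB.instance Definition _ := GRing.isNmodule.Build (pelt E) paddA paddC padd0.

End TotalSum.

(** * Cancellation and the induced order *)

Section Order.
Variable E : effectAlgebra.
Implicit Types a b c d : pelt E.
Local Open Scope ring_scope.

Definition pone : pelt E := Some ea_one.

Lemma defD a b : isSome (a + b) -> isSome a /\ isSome b.
Proof. by case: a b => [x|] [y|]. Qed.

Lemma defDl a b : isSome (a + b) -> isSome a.
Proof. by case/defD. Qed.

Lemma defDr a b : isSome (a + b) -> isSome b.
Proof. by case/defD. Qed.

Lemma compl a : isSome a -> exists b, a + b = pone.
Proof. exact: padd_compl. Qed.

(** If [d] is the complement of [a + b], then [b] and [c] both complement [a + d]. Definedness
    matters, since an undefined sum absorbs everything. *)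
Lemma cancel_def a b c : isSome (a + b) -> a + b = a + c -> b = c.
Proof.
move=> /compl[d abd] e; apply: (@padd_cancel_one E (a + d)).
- by rewrite -[padd _ _]/(a + d + b) addrAC.
- by rewrite -[padd _ _]/(a + d + c) addrAC -e.
Qed.

Lemma one_add a : isSome (pone + a) -> a = 0.
Proof.
case: a => [x|] //= H; congr Some; apply: ea_zero_one_law.
by move=> e; move: H; rewrite -[pone + Some x]/(oplus ea_one x) e.
Qed.

Lemma add_eq0 a b : a + b = 0 -> a = 0 /\ b = 0.
Proof.
suff H c d : c + d = 0 -> d = 0.
  by move=> e; split; apply: H; [rewrite addrC|]; exact: e.
move=> e; apply: one_add.
suff: isSome (pone + (c + d)) by rewrite addrCA => /defDr.
by rewrite e addr0.
Qed.

Definition ple a b : Prop := exists c, a + c = b.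
Notation "a <~ b" := (ple a b) (at level 70).

Lemma ple_refl a : a <~ a. Proof. by exists 0; rewrite addr0. Qed.

Lemma ple_trans b a c : a <~ b -> b <~ c -> a <~ c.
Proof. by move=> [d <-] [e <-]; exists (d + e); rewrite addrA. Qed.

Lemma ple0 a : 0 <~ a. Proof. by exists a; rewrite add0r. Qed.

Lemma ple_addr a b : a <~ a + b. Proof. by exists b. Qed.

Lemma ple_addl a b : a <~ b + a. Proof. by rewrite addrC; exists b. Qed.

Lemma pleD a b c d : a <~ b -> c <~ d -> a + c <~ b + d.
Proof. by move=> [e <-] [f <-]; exists (e + f); rewrite addrACA. Qed.

Lemma ple_def a b : a <~ b -> isSome b -> isSome a.
Proof. by move=> [c <-] /defDl. Qed.

Lemma ple_add2l c a b : isSome (c + b) -> c + a <~ c + b -> a <~ b.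
Proof.
move=> H [d]; rewrite -addrA => e; exists d.
by apply: (@cancel_def c); rewrite e.
Qed.

Lemma ple_anti a b : isSome b -> a <~ b -> b <~ a -> a = b.
Proof.
move=> bD [c e]; rewrite -e in bD *; move=> [d]; rewrite -addrA => f.
have aD : isSome (a + 0) by rewrite addr0; apply: defDl bD.
have /esym/add_eq0[-> _] : 0 = c + d by apply: (cancel_def aD); rewrite f addr0.
by rewrite addr0.
Qed.

Lemma ple_eq0 a : a <~ 0 -> a = 0.
Proof. by move=> [c /add_eq0[]]. Qed.

Lemma ple_sum (I : Type) (r : seq I) (P : pred I) (F G : I -> pelt E) :
  (forall i, P i -> F i <~ G i) ->
  \sum_(i <- r | P i) F i <~ \sum_(i <- r | P i) G i.
Proof.
move=> H; elim/big_rec2: _ => [|i x y /H]; first exact: ple_refl.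
by move=> ? ?; apply: pleD.
Qed.

Lemma ple_sum1 (I : finType) (A : {pred I}) (F : I -> pelt E) i :
  i \in A -> F i <~ \sum_(j in A) F j.
Proof. by move=> iA; rewrite (bigD1 i) //=; apply: ple_addr. Qed.

Lemma ea_leE (x y : E) : ea_le x y <-> Some x <~ Some y.
Proof.
split=> [[z xz]|[[z|] xz]] //; first by exists (Some z).
by exists z.
Qed.

Lemma oplus_seqE (s : seq E) : oplus_seq s = \sum_(x <- s) (Some x : pelt E).
Proof. by elim: s => [|x s IH]; rewrite ?big_nil ?big_cons //= IH. Qed.

End Order.

Notation "a <~ b" := (ple a b) (at level 70).

(** * Splitting an element along a finite sum *)

Section Splitting.
Variable E : effectAlgebra.
Implicit Types a b c u v w : pelt E.
Local Open Scope ring_scope.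

Definition sub_closed_pred (C : pelt E -> Prop) : Prop :=
  [/\ C (pone E), forall a, C a -> isSome a,
      forall a b, C a -> C b -> isSome (a + b) -> C (a + b) &
      forall a b, C a -> C (a + b) -> C b].

Definition rdp_pred (C : pelt E -> Prop) : Prop :=
  forall u v1 v2, C u -> C v1 -> C v2 -> isSome (v1 + v2) -> u <~ v1 + v2 ->
    exists u1 u2, [/\ C u1, C u2, u1 <~ v1, u2 <~ v2 & u = u1 + u2].

(* Instantiated with [N u v := isSome (u + v)] in a homogeneous effect algebra
   and with [N u v := isSome v] in one with the Riesz decomposition property. *)
Lemma split_sum (C : pelt E -> Prop) (N : pelt E -> pelt E -> Prop)
    (CD : forall a b, C a -> C b -> isSome (a + b) -> C (a + b)) (C0 : C 0)
    (Ndef : forall u v, N u v -> isSome v)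
    (Nle : forall u v u' v', u' <~ u -> v' <~ v -> N u v -> N u' v')
    (split2 : forall u v1 v2, C u -> C v1 -> C v2 -> N u (v1 + v2) ->
      u <~ v1 + v2 ->
      exists u1 u2, [/\ C u1, C u2, u1 <~ v1, u2 <~ v2 & u = u1 + u2])
    (J : eqType) (s : seq J) (v : J -> pelt E) u :
  uniq s -> (forall j, C (v j)) -> C u ->
  N u (\sum_(j <- s) v j) -> u <~ \sum_(j <- s) v j ->
  exists d : J -> pelt E,
    [/\ forall j, C (d j), forall j, d j <~ v j & u = \sum_(j <- s) d j].
Proof.
move=> + Cv; elim: s u => [|j s IH] u /=.
  move=> _ Cu _; rewrite big_nil => /ple_eq0 ->.
  by exists (fun=> 0); split=> [//|j|]; [exact: ple0|rewrite big_nil].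
move=> /andP[js us] Cu; rewrite big_cons => Nu.
have sD : isSome (\sum_(i <- s) v i) by apply: defDr (Ndef _ _ Nu).
have Csum : C (\sum_(i <- s) v i).
  elim: {IH js us Nu} s sD => [|k s IH]; first by rewrite big_nil.
  by rewrite big_cons => kD; apply: CD => //; apply: IH; apply: defDr kD.
case/(split2 _ _ _ Cu (Cv j) Csum Nu) => u1 [u2 [Cu1 Cu2 le1 le2 ue]].
have N2 : N u2 (\sum_(i <- s) v i).
  by apply: Nle Nu; rewrite ?ue; exact: ple_addl.
have [d [Cd dv u2E]] := IH _ us Cu2 N2 le2.
exists (fun i => if i == j then u1 else d i); split=> [i|i|].
- by case: ifP.
- by case: eqP => [->|_].
rewrite big_cons eqxx ue u2E; congr (_ + _).
apply: eq_big_seq => i ins.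
by case: eqP ins js => // -> ->.
Qed.

Lemma diff_fun (I : Type) (f g : I -> pelt E) :
  (forall i, f i <~ g i) -> exists h, forall i, f i + h i = g i.
Proof.
by move=> /(@choice _ _ (fun i c => f i + c = g i))[h hE]; exists h.
Qed.

Section Homogeneous.
Hypothesis E_hom : homogeneous E.

(** Definedness of [u + (v1 + v2)] is the upper bound [u'] in homogeneity: a complement [t] of that
    sum gives [u' = (v1 + v2) + t]. *)
Lemma hom_split2 u v1 v2 : isSome (u + (v1 + v2)) -> u <~ v1 + v2 ->
  exists u1 u2, [/\ u1 <~ v1, u2 <~ v2 & u = u1 + u2].
Proof.
move=> D; have [] := defD D; case: u D => [u|] // D _.
case ve : (v1 + v2) => [v|] // _ uv.
have [] : isSome v1 /\ isSome v2 by apply: defD; rewrite ve.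
case: v1 v2 ve D => [v1|] [v2|] // ve D _ _.
have vu : ea_le v (orthosupp u).
  have [[t|] tE] := compl D; last by move: tE; rewrite addrC.
  move: tE; rewrite ve -addrA; case e : ((Some v : pelt E) + Some t) => [r|] //.
  by move=> /orthosuppP <-; exists t.
have [u1 [u2 [l1 l2 ue]]] := E_hom ve ((ea_leE _ _).2 uv) vu.
by exists (Some u1), (Some u2); split=> //; apply/ea_leE.
Qed.

(** Summands outside [A] receive zero, which makes [d] usable as one half of a small splitting of a
    whole word. *)
Lemma hom_split (J : finType) (A : {pred J}) (v : J -> pelt E) u :
  isSome (u + \sum_(j in A) v j) -> u <~ \sum_(j in A) v j ->
  exists d : J -> pelt E,
    [/\ forall j, d j <~ v j, u = \sum_(j in A) d j &
        forall j, j \notin A -> d j = 0].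
Proof.
rewrite -big_enum => D uv.
have [] := @split_sum (fun=> True) (fun u v => isSome (u + v)) _ _ _ _ _
  J (enum A) v u (enum_uniq _) _ _ D uv => //.
- by move=> a b; apply: defDr.
- by move=> a b c d ca db; apply: ple_def; apply: pleD.
- move=> a b c _ _ _ H1 H2.
  by have [u1 [u2 []]] := hom_split2 H1 H2; exists u1, u2.
move=> d [_ dv ue]; exists (fun j => if j \in A then d j else 0).
split=> [j||j /negbTE -> //]; first by case: ifP => // _; apply: ple0.
by rewrite ue big_enum; apply: eq_bigr => j ->.
Qed.
End Homogeneous.

Section Rdp.
Variable C : pelt E -> Prop.
Hypotheses (Csub : sub_closed_pred C) (Crdp : rdp_pred C).

Lemma sub_closed0 : C 0.
Proof. by case: Csub => C1 _ _; apply; [exact: C1|rewrite addr0]. Qed.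

Lemma rdp_split (J : eqType) (s : seq J) (v : J -> pelt E) u :
  uniq s -> (forall j, C (v j)) -> C u ->
  isSome (\sum_(j <- s) v j) -> u <~ \sum_(j <- s) v j ->
  exists d : J -> pelt E,
    [/\ forall j, C (d j), forall j, d j <~ v j & u = \sum_(j <- s) d j].
Proof.
move=> us Cv Cu D uv; apply: (@split_sum C (fun _ v => isSome v)) => //.
- by case: Csub.
- exact: sub_closed0.
- by move=> ? ? ? ? _; apply: ple_def.
Qed.

(** Induction on rows: the first [a i] is split along all the [b j], and by cancellation the
    remainders [f j] sum to the remaining rows. *)
Lemma rdp_refinement (I J : eqType) (s : seq I) (t : seq J)
    (a : I -> pelt E) (b : J -> pelt E) :
  uniq s -> uniq t -> (forall i, C (a i)) -> (forall j, C (b j)) ->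
  isSome (\sum_(i <- s) a i) -> \sum_(i <- s) a i = \sum_(j <- t) b j ->
  exists m : I -> J -> pelt E,
    [/\ forall i j, C (m i j),
        forall i, i \in s -> a i = \sum_(j <- t) m i j &
        forall j, j \in t -> b j = \sum_(i <- s) m i j].
Proof.
have [_ Cdef CD CB] := Csub.
move=> + ut Ca; elim: s b => [|i s IH] b /=.
  rewrite big_nil => _ Cb _ e; exists (fun _ _ => 0); split=> //.
    by move=> *; apply: sub_closed0.
  move=> j jt; rewrite big_nil; apply: ple_eq0.
  by rewrite e (bigD1_seq j) //=; apply: ple_addr.
rewrite !big_cons => /andP[ins us] Cb D e; rewrite e in D.
have aile : a i <~ \sum_(j <- t) b j by rewrite -e; apply: ple_addr.
have [d [Cd db aE]] := rdp_split ut Cb (Ca i) D aile.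
have [f fE] := diff_fun db.
have Cf j : C (f j) by apply: (CB (d j)); rewrite ?fE.
have e' : \sum_(i <- s) a i = \sum_(j <- t) f j.
  apply: (@cancel_def _ (a i)); first by rewrite e.
  by rewrite e aE -big_split; apply: eq_bigr => j _ /=; rewrite fE.
have D' : isSome (\sum_(i <- s) a i) by rewrite -e in D; apply: defDr D.
have [m [Cm mr mc]] := IH f us Cf D' e'.
exists (fun k => if k == i then d else m k); split=> [k j|k|j jt].
- by case: ifP.
- by rewrite inE; case: eqP => [-> //|_] /=; apply: mr.
rewrite big_cons eqxx -fE mc //; congr (_ + _).
apply: eq_big_seq => k ks.
by case: eqP ks ins => // -> ->.
Qed.

End Rdp.
End Splitting.

(** * Decompositions of one, refinements and small splittings *)

Section Words.
Variable E : effectAlgebra.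
Implicit Types a b u v w : pelt E.
Local Open Scope ring_scope.

Record word := Word { widx : finType; wval :> widx -> pelt E }.
Implicit Types P Q R : word.

Definition unity P : Prop := \sum_i P i = pone E.

Definition wsum P (A : {set widx P}) : pelt E := \sum_(i in A) P i.

Definition refines P Q : Prop :=
  exists f : widx Q -> widx P, forall i, P i = \sum_(k | f k == i) Q k.

Definition splitw P (c e : widx P -> pelt E) : word :=
  @Word (widx P * bool)%type (fun k => if k.2 then c k.1 else e k.1).

(** [c i + P i] being defined means that [c i] is below the complement of [P i], the condition under
    which homogeneity splits [c i] along any finer decomposition of [P i]. *)
Definition small_split P (c e : widx P -> pelt E) : Prop :=
  forall i, c i + e i = P i /\ isSome (c i + P i).

Definition directed (D : word -> Prop) : Prop :=
  forall P Q, D P -> D Q -> exists R, [/\ D R, refines P R & refines Q R].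

Inductive split_closure (D : word -> Prop) : word -> Prop :=
| split_closure_base P : D P -> split_closure D P
| split_closure_step P c e :
    split_closure D P -> small_split c e -> split_closure D (@splitw P c e).

Definition subsum (D : word -> Prop) a : Prop :=
  exists P, D P /\ exists A, a = @wsum P A.

Lemma refines_refl P : refines P P.
Proof. by exists id => i; rewrite big_pred1_eq. Qed.

Lemma refines_sum P Q (f : widx Q -> widx P) (A : {pred widx P}) :
  (forall i, P i = \sum_(k | f k == i) Q k) ->
  \sum_(i in A) P i = \sum_(k | f k \in A) Q k.
Proof.
move=> fE; rewrite (partition_big f (mem A)) //=; apply: eq_bigr => i iA.
by rewrite fE; apply: eq_bigl => k; case: eqP => [->|]; rewrite ?iA ?andbF.
Qed.

Lemma refines_wsum P Q A : refines P Q -> exists B, @wsum P A = @wsum Q B.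
Proof.
case=> f fE; exists [set k | f k \in A]; rewrite /wsum (refines_sum _ fE).
by apply: eq_bigl => k; rewrite inE.
Qed.

Lemma refines_trans Q P R : refines P Q -> refines Q R -> refines P R.
Proof.
move=> [f fE] [g gE]; exists (f \o g) => i.
by rewrite fE (refines_sum [pred k | f k == i] gE).
Qed.

Lemma refines_unity P Q : refines P Q -> unity P -> unity Q.
Proof.
rewrite /unity => -[f fE] <-.
by rewrite (refines_sum predT fE).
Qed.

Lemma unity_def P (A : {pred widx P}) : unity P -> isSome (\sum_(i in A) P i).
Proof.
rewrite /unity (bigID [in A]) /= => e.
have: isSome (pone E) by [].
by rewrite -e => /defDl.
Qed.

Lemma splitw_sum P c e (b : bool) (A : {pred widx P}) :
  \sum_(k | (k.1 \in A) && (k.2 == b)) @splitw P c e k =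
  \sum_(i in A) (if b then c i else e i).
Proof.
rewrite -(pair_big (mem A) (pred1 b)
  (fun i (b : bool) => if b then c i else e i)) /=.
by apply: eq_bigr => i _; rewrite big_pred1_eq.
Qed.

Lemma splitw_fst P c e i : small_split c e ->
  P i = \sum_(k | k.1 == i) @splitw P c e k.
Proof.
move=> ce.
rewrite (bigID (fun k => k.2 == true)) /= -(ce i).1.
congr (_ + _); first by rewrite (splitw_sum c e true (pred1 i)) big_pred1_eq.
transitivity (\sum_(k | (k.1 \in pred1 i) && (k.2 == false)) splitw c e k).
  by rewrite splitw_sum big_pred1_eq.
by apply: eq_bigl => -[j []].
Qed.

Lemma refines_splitw P c e : small_split c e -> refines P (@splitw P c e).
Proof. by move=> ce; exists fst => i; apply: splitw_fst. Qed.

Lemma wsumU P (A B : {set widx P}) : [disjoint A & B] ->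
  wsum (A :|: B) = wsum A + wsum B.
Proof.
by move=> dAB; rewrite /wsum -bigU //; apply: eq_bigl => i; rewrite !inE.
Qed.

Lemma wsumID P (A B : {set widx P}) : wsum A = wsum (A :&: B) + wsum (A :\: B).
Proof. exact: big_setID. Qed.

Section Homogeneous.
Hypothesis E_hom : homogeneous E.

(** Homogeneity distributes each [c i] over the pieces of [P'] refining [P i]. Each [c' j] lies
    below [c i] and each [P' j] below [P i], so smallness is inherited. *)
Lemma small_split_lift P P' c e : unity P -> refines P P' -> @small_split P c e ->
  exists c' e', @small_split P' c' e' /\ refines (splitw c e) (splitw c' e').
Proof.
move=> uP [f fE] ce.
have /choice[d dP] i : exists d : widx P' -> pelt E,
    [/\ forall j, d j <~ P' j, c i = \sum_(j | f j == i) d j &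
        forall j, j \notin [pred j | f j == i] -> d j = 0].
  apply: (hom_split E_hom (A := [pred j | f j == i])); rewrite -fE.
    exact: (ce i).2.
  by rewrite -(ce i).1; apply: ple_addr.
(* Each [j] refines exactly one summand, that of index [f j], so the separate splittings glue to one
   function. *)
pose c' j := d (f j) j.
have [e' e'E] : exists h, forall j, c' j + h j = P' j.
  by apply: diff_fun => j; have [+ _ _] := dP (f j); apply.
have cE i : c i = \sum_(j | f j == i) c' j.
  have [_ -> _] := dP i; apply: eq_bigr => j /eqP e0.
  by rewrite /c' e0.
exists c', e'; split=> [j|].
  split=> //; apply: ple_def (ce (f j)).2; apply: pleD.
    by rewrite cE (bigD1 j) //=; apply: ple_addr.
  by rewrite fE (bigD1 j) //=; apply: ple_addr.
exists (fun k => (f k.1, k.2)) => -[i b] /=.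
have -> : \sum_(k | (f k.1, k.2) == (i, b)) splitw c' e' k =
    \sum_(j | f j == i) (if b then c' j else e' j).
  rewrite -(splitw_sum c' e' b [pred j | f j == i]).
  by apply: eq_bigl => k; rewrite xpair_eqE.
case: b; first exact: cE.
apply: (@cancel_def _ (c i)); first by rewrite (ce i).1; apply: defDr (ce i).2.
rewrite (ce i).1 {1}cE fE -big_split.
by apply: eq_bigr => j _ /=; rewrite e'E.
Qed.

Lemma split_closure_unity D P :
  (forall Q, D Q -> unity Q) -> split_closure D P -> unity P.
Proof.
move=> uD; elim=> [Q /uD //|Q c e _ uQ ce].
by apply: refines_unity uQ; apply: refines_splitw.
Qed.

(** A splitting of [Q] lifts to any refinement of [Q] in the closure, so common refinements survive
    each step; induction on both derivations reduces to [D]. *)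
Lemma split_closure_directed D :
  (forall Q, D Q -> unity Q) -> directed D -> directed (split_closure D).
Proof.
move=> uD dD.
have step Q c e R : split_closure D Q -> small_split c e -> split_closure D R ->
    refines Q R -> exists R', [/\ split_closure D R', refines (@splitw Q c e) R' &
      refines R R'].
  move=> DQ ce DR QR.
  have uQ : unity Q := split_closure_unity uD DQ.
  have [c' [e' [ce' r]]] := small_split_lift uQ QR ce.
  exists (splitw c' e'); split=> //; first exact: split_closure_step.
  exact: refines_splitw.
move=> P Q DP; elim: DP Q => {P} [P DP Q DQ|P c e DP IH ce Q DQ].
  elim: DQ => {Q} [Q DQ|Q c e DQ [R [DR PR QR]] ce].
    have [R [DR PR QR]] := dD _ _ DP DQ.
    by exists R; split=> //; apply: split_closure_base.
  have [R' [DR' QR' RR']] := step _ _ _ _ DQ ce DR QR.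
  by exists R'; split=> //; apply: refines_trans RR'.
have [R [DR PR QR]] := IH Q DQ.
have [R' [DR' PR' RR']] := step _ _ _ _ DP ce DR PR.
by exists R'; split=> //; apply: refines_trans RR'.
Qed.

(** * Subsums of a directed family closed under small splittings *)

Section Subsums.
Variable D : word -> Prop.
Hypotheses (D_ex : exists P, D P) (uD : forall P, D P -> unity P)
  (dirD : directed D)
  (stepD : forall P c e, D P -> small_split c e -> D (@splitw P c e)).

Lemma subsum_directed a b : subsum D a -> subsum D b ->
  exists P, D P /\ exists A B, a = @wsum P A /\ b = @wsum P B.
Proof.
move=> [P [DP [A ->]]] [Q [DQ [B ->]]].
have [R [DR /(refines_wsum A)[A' ->] /(refines_wsum B)[B' ->]]] := dirD DP DQ.
by exists R; split=> //; exists A', B'.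
Qed.

(** The splitting is made on the whole word, so that the partial sums of [c] over all [B] are
    subsums of one new word of the family. *)
Lemma subsum_split P (A : {set widx P}) u : D P ->
  isSome (u + wsum A) -> u <~ wsum A ->
  exists c e, [/\ @small_split P c e, u = \sum_(i in A) c i &
    forall B : {set widx P}, subsum D (\sum_(i in B) c i)].
Proof.
move=> DP uAD uA; have [c [cP ue c0]] := hom_split E_hom uAD uA.
have [e ce] := diff_fun cP.
have sce : small_split c e.
  move=> i; split=> //; have [iA|/c0->] := boolP (i \in A); last first.
    rewrite add0r; have := unity_def predT (uD DP).
    by apply: ple_def; apply: ple_sum1.
  by apply: ple_def uAD; rewrite ue; apply: pleD; apply: ple_sum1.
exists c, e; split=> // B; exists (splitw c e); split; first exact: stepD.
exists [set k | (k.1 \in B) && (k.2 == true)].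
rewrite -(splitw_sum c e true [in B]) /wsum.
by apply: eq_bigl => k; rewrite inE.
Qed.

Lemma subsum_small a b : subsum D a -> b <~ a -> isSome (b + a) -> subsum D b.
Proof.
move=> [P [DP [A ->]]] ba baD.
by have [c [e [_ -> /(_ A)]]] := subsum_split DP baD ba.
Qed.

(** The overlap [u] of [A] and [A'] is counted twice in a defined sum, so cancellation puts [u]
    below the sum over [R], the complement of the union. As [u + wsum R] is defined, a copy of [u]
    can be split off from [R] and replace the overlap in [A']. *)
Lemma disjoint_subsums P (A A' : {set widx P}) : D P ->
  isSome (wsum A + wsum A') ->
  exists Q, [/\ D Q, refines P Q & exists C C' : {set widx Q},
    [/\ [disjoint C & C'], wsum A = wsum C & wsum A' = wsum C']].
Proof.
move=> DP AA'D; set R := ~: (A :|: A'); set u := wsum (A :&: A').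
have e0 : wsum A + wsum A' = wsum (A :|: A') + u.
  have -> : A :|: A' = A :|: (A' :\: A).
    by apply/setP => i; rewrite !inE; case: (i \in A).
  rewrite wsumU; last first.
    by rewrite -setI_eq0; apply/eqP/setP => i; rewrite !inE; case: (i \in A).
  by rewrite -addrA (addrC (wsum (A' :\: A))) /u (setIC A) -wsumID.
have e1 : wsum (A :|: A') + wsum R = pone E.
  rewrite -wsumU; last by rewrite -setI_eq0 setICr.
  by rewrite setUCr -(uD DP); apply: eq_bigl => i; rewrite inE.
have [t tE] := compl AA'D; rewrite e0 -addrA in tE.
have RE : u + t = wsum R.
  by apply: (@cancel_def _ (wsum (A :|: A'))); rewrite tE.
have uRD : isSome (u + wsum R).
  rewrite -wsumU; first exact: unity_def (uD DP).
  rewrite -setI_eq0; apply/eqP/setP => i; rewrite !inE.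
  by case: (i \in A); case: (i \in A').
have uR : u <~ wsum R by exists t.
have [c [e [ce uE _]]] := subsum_split DP uRD uR.
exists (splitw c e); split; [exact: stepD|exact: refines_splitw|].
pose pre (B : {set widx P}) : {set widx (splitw c e)} := [set k | k.1 \in B].
have preE (B : {set widx P}) : wsum B = wsum (pre B).
  have fstE i := splitw_fst i ce.
  rewrite /wsum (@refines_sum _ (splitw c e) fst [in B] fstE).
  by apply: eq_bigl => k; rewrite inE.
pose C2 : {set widx (splitw c e)} := [set k | (k.1 \in R) && (k.2 == true)].
have C2E : wsum C2 = u.
  by rewrite uE -(splitw_sum c e true [in R]); apply: eq_bigl => k; rewrite inE.
exists (pre A), (pre (A' :\: A) :|: C2); split; last 2 first.
- exact: preE.
- rewrite wsumU; first by rewrite -preE C2E addrC /u setIC -wsumID.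
  rewrite -setI_eq0; apply/eqP/setP => k; rewrite !inE.
  by case: (k.1 \in A'); rewrite ?orbT ?andbF.
rewrite -setI_eq0; apply/eqP/setP => k; rewrite !inE.
by case: (k.1 \in A).
Qed.

Lemma subsum_sub_closed : sub_closed_pred (subsum D).
Proof.
have C1 : subsum D (pone E).
  have [P DP] := D_ex; exists P; split=> //; exists [set: _].
  by rewrite /wsum -(uD DP); apply: eq_bigl => i; rewrite inE.
have CD a : subsum D a -> isSome a.
  by move=> [P [DP [A ->]]]; apply: unity_def (uD DP).
have Cadd a b : subsum D a -> subsum D b -> isSome (a + b) -> subsum D (a + b).
  move=> Ca Cb; have [P [DP [A [B [-> ->]]]]] := subsum_directed Ca Cb.
  move=> /(disjoint_subsums DP)[Q [DQ _ [C [C' [dC -> ->]]]]].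
  by exists Q; split=> //; exists (C :|: C'); rewrite wsumU.
have Ccompl a b : subsum D a -> a + b = pone E -> subsum D b.
  move=> [P [DP [A ->]]] ab; exists P; split=> //; exists (~: A).
  apply: (@cancel_def _ (wsum A)); rewrite ab // -wsumU ?setUCr.
    by rewrite /wsum -(uD DP); apply: eq_bigl => i; rewrite inE.
  by rewrite -setI_eq0 setICr.
(* Differences reduce to complements: if [c] complements [a + b], then [b] complements [c + a]. *)
split=> // a b Ca Cab; have [c abc] := compl (CD _ Cab).
have Cc := Ccompl _ _ Cab abc.
apply: (Ccompl (c + a)); last by rewrite -addrA addrC.
apply: Cadd => //; have : isSome (pone E) by [].
by rewrite -abc addrC addrA => /defDl.
Qed.

(** In a common word [w] is the sum over [K], and [v1], [v2] are sums over disjoint [C], [C']. The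
    part of [K] inside [C :|: C'] splits at once. By cancellation the sum over the rest [G] of [K]
    is below that over the rest [F] of [C :|: C']; as [G] and [F] are disjoint, homogeneity
    distributes it along [F]. *)
Lemma subsum_rdp : rdp_pred (subsum D).
Proof.
have [_ _ Cadd _] := subsum_sub_closed.
move=> w v1 v2 Cw Cv1 Cv2 vD wv.
have [P [DP [A0 [A0' [v1E v2E]]]]] := subsum_directed Cv1 Cv2.
have [P1 [DP1 [K1 wE]]] := Cw.
have [R [DR PR P1R]] := dirD DP DP1.
have [A AE] := refines_wsum A0 PR; have [A' A'E] := refines_wsum A0' PR.
have [K2 K2E] := refines_wsum K1 P1R.
rewrite v1E v2E AE A'E in vD.
have [Q [DQ RQ [C [C' [dC e1 e2]]]]] := disjoint_subsums DR vD.
have [K K2K] := refines_wsum K2 RQ.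
rewrite {}wE {}K2E {}K2K in Cw wv *.
rewrite {}v1E {}v2E {}AE {}A'E {}e1 {}e2 in Cv1 Cv2 vD wv *.
set F := (C :|: C') :\: K; set G := K :\: (C :|: C').
have GFD : isSome (wsum G + wsum F).
  rewrite -wsumU; first exact: unity_def (uD DQ).
  by rewrite -setI_eq0; apply/eqP/setP => k; rewrite !inE;
     case: (k \in K); rewrite ?andbF.
have wE : wsum K = wsum (K :&: (C :|: C')) + wsum G by rewrite -wsumID.
have vE : wsum C + wsum C' = wsum (K :&: (C :|: C')) + wsum F.
  by rewrite -wsumU // setIC -wsumID.
have GF : wsum G <~ wsum F.
  by rewrite vE in vD wv; apply: (ple_add2l vD); rewrite -wE.
have [c [e [ce GE Cc]]] := subsum_split DQ GFD GF.
have cP (B : {set widx Q}) : \sum_(i in B) c i <~ wsum B.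
  by apply: ple_sum => i _; exists (e i); apply: (ce i).1.
have sub (B : {set widx Q}) : subsum D (wsum B) by exists Q; split=> //; exists B.
have wsE : wsum K = (wsum (K :&: C) + \sum_(i in C :\: K) c i) +
    (wsum (K :&: C') + \sum_(i in C' :\: K) c i).
  rewrite addrACA -wsumU; last first.
    by apply: disjointWl (subsetIr _ _) _; apply: disjointWr (subsetIr _ _) dC.
  rewrite -setIUr wE GE; congr (_ + _); rewrite -bigU /=; last first.
    apply: disjointWl (subsetDl _ _) _; apply: disjointWr (subsetDl _ _) dC.
  by apply: eq_bigl => k; rewrite !inE andb_orr.
have leB (B : {set widx Q}) : wsum (K :&: B) + \sum_(i in B :\: K) c i <~ wsum B.
  by rewrite (wsumID B K) setIC; apply: pleD; [exact: ple_refl|exact: cP].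
have wD : isSome (wsum K) := unity_def _ (uD DQ).
exists (wsum (K :&: C) + \sum_(i in C :\: K) c i),
  (wsum (K :&: C') + \sum_(i in C' :\: K) c i); split=> //.
- by apply: Cadd => //; rewrite wsE in wD; apply: defDl wD.
- by apply: Cadd => //; rewrite wsE in wD; apply: defDr wD.
Qed.

End Subsums.
End Homogeneous.
End Words.

(** [Zorn_bigcup] also asks for the union of the empty chain. Applying it to the sets whose union
    with [A0] satisfies [P] reduces that case to [P A0]. *)
Lemma Zorn_above (T : Type) (P : set (set T)) (A0 : set T) : P A0 ->
  (forall F : set (set T), (F !=set0 -> F `<=` P ->
    total_on F classical_sets.subset -> P (\bigcup_(X in F) X))%classic) ->
  exists A, [/\ (A0 `<=` A)%classic, P A &
    forall B, (A `<=` B)%classic -> P B -> B = A].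
Proof.
move=> PA0 Pchain.
have [F FP Ftot|A [PA Amax]] := @Zorn_bigcup T (fun X => P (A0 `|` X)%classic).
  have [[X0 FX0]|/set0P/negP/negbNE/eqP->] := pselect (F !=set0)%classic.
    pose G := [set (A0 `|` X)%classic | X in F]%classic.
    have -> : (A0 `|` \bigcup_(X in F) X = \bigcup_(X in G) X)%classic.
      apply/seteqP; split=> x.
        case=> [A0x|[X FX Xx]].
          by exists (A0 `|` X0)%classic; [exists X0|left].
        by exists (A0 `|` X)%classic; [exists X|right].
      by move=> [_ [X FX <-] [A0x|Xx]]; [left|right; exists X].
    apply: Pchain; first by exists (A0 `|` X0)%classic; exists X0.
      by move=> _ [X /FP ? <-].
    move=> _ _ [X FX <-] [Y FY <-].
    by have [?|?] := Ftot _ _ FX FY; [left|right]; apply: classical_sets.setUS.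
  by rewrite bigcup_set0 classical_sets.setU0.
exists (A0 `|` A)%classic; split=> //.
move=> B AB PB; apply/seteqP; split=> // x Bx.
apply: contrapT => nx; apply: (Amax B).
  split; first by move=> y Ay; apply: AB; right.
  by move=> BA; apply: nx; right; apply: BA.
suff -> : (A0 `|` B)%classic = B by [].
by apply/seteqP; split=> y; [case=> // A0y; apply: AB; left|right].
Qed.

(** * Existence of blocks and their closure under small parts *)

Section Blocks.
Variable E : effectAlgebra.
Implicit Types (a b c u v w : pelt E) (X : set E).
Local Open Scope ring_scope.

Definition carrier X a : Prop := if a is Some x then X x else False.

Definition rdp_subalgebra X : Prop :=
  sub_closed_pred (carrier X) /\ rdp_pred (carrier X).

Lemma sub_closed_carrier (Q : subEffectAlgebra E) : sub_closed_pred (carrier Q).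
Proof.
split; first exact: sub_one.
- by case.
- move=> [x|] [y|] //; case e : (_ + _) => [z|] // Qx Qy _.
  by have [+ _ _] := sub_closed Q e; apply.
- move=> [x|] [y|] //; case e : (_ + _) => [z|] // Qx Qz.
  by have [_ + _] := sub_closed Q e; apply.
Qed.

Lemma subalgebra_of (C : pelt E -> Prop) : sub_closed_pred C ->
  exists Q : subEffectAlgebra E, forall x, sub_carrier Q x <-> C (Some x).
Proof.
case=> C1 _ CD CB.
have H x y z : oplus x y = Some z ->
    [/\ C (Some x) -> C (Some y) -> C (Some z),
        C (Some x) -> C (Some z) -> C (Some y) &
        C (Some y) -> C (Some z) -> C (Some x)].
  move=> e; have e' : (Some x : pelt E) + Some y = Some z := e.
  split; first by rewrite -e' => Cx Cy; apply: CD; rewrite // e'.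
  - by rewrite -e'; apply: CB.
  - by rewrite -e' addrC; apply: CB.
by exists (@SubEffectAlgebra E (fun x => C (Some x)) C1 H).
Qed.

Lemma carrier_le X a b : sub_closed_pred (carrier X) ->
  carrier X a -> carrier X b -> a <~ b -> exists c, carrier X c /\ a + c = b.
Proof.
move=> [_ _ _ CB] Xa Xb [c e]; exists c; split=> //.
by apply: CB Xa _; rewrite e.
Qed.

Section SubOrder.
Variable Q : subEffectAlgebra E.

Lemma sub_leE (x y : sub_effectAlgebra Q) :
  ea_le x y <-> (Some (sval x) : pelt E) <~ Some (sval y).
Proof.
split=> [[z /sub_oplus_some e]|]; first by exists (Some (sval z)).
move=> /(@carrier_le Q (Some (sval x)) (Some (sval y))
  (sub_closed_carrier Q) (svalP x) (svalP y)).
by move=> [[z|] [Qz e]] //; exists (exist _ z Qz); apply/sub_oplus_some.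
Qed.

Lemma sub_rdpE :
  riesz_decomposition (sub_effectAlgebra Q) <-> rdp_pred (carrier Q).
Proof.
split=> H.
  move=> [u|] [v1|] [v2|] // Qu Q1 Q2.
  case e : (_ + _) => [v|] // _ uv.
  have Qv : sub_carrier Q v by have [+ _ _] := sub_closed Q e; apply.
  have [|//|u1 [u2 [/sub_leE l1 /sub_leE l2 /sub_oplus_some ue]]] :=
    H (exist _ u Qu) (exist _ v1 Q1) (exist _ v2 Q2) (exist _ v Qv).
  - exact/sub_oplus_some.
  - exact/sub_leE.
  exists (Some (sval u1)), (Some (sval u2)).
  by split=> //; exact: svalP.
move=> u v1 v2 v /sub_oplus_some e /sub_leE uv.
have e' : (Some (sval v1) : pelt E) + Some (sval v2) = Some (sval v) := e.
have [||[u1|] [[u2|] [// Q1 Q2 l1 l2 ue]]] :=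
  H (Some (sval u)) (Some (sval v1)) (Some (sval v2))
    (svalP u) (svalP v1) (svalP v2).
- by rewrite e'.
- by rewrite e'.
exists (exist _ u1 Q1), (exist _ u2 Q2).
by split; [apply/sub_leE|apply/sub_leE|apply/sub_oplus_some].
Qed.

End SubOrder.

Lemma rdp_subalgebra_chain (F : set (set E)) : (F !=set0)%classic ->
  (forall X, F X -> rdp_subalgebra X) -> total_on F classical_sets.subset ->
  rdp_subalgebra (\bigcup_(X in F) X)%classic.
Proof.
move=> [X0 FX0] FR Ftot; set U := (\bigcup_(X in F) X)%classic.
have inU X a : F X -> carrier X a -> carrier U a.
  by case: a => // x FX Xx; exists X.
have Uin a : carrier U a -> exists X, F X /\ carrier X a.
  by case: a => // x [X FX Xx]; exists X.
have sub X Y a : (X `<=` Y)%classic -> carrier X a -> carrier Y a.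
  by case: a => // x; apply.
have Uin2 a b : carrier U a -> carrier U b ->
    exists X, [/\ F X, carrier X a & carrier X b].
  move=> /Uin[X [FX Xa]] /Uin[Y [FY Yb]].
  by have [XY|YX] := Ftot _ _ FX FY; [exists Y|exists X]; split=> //;
    [apply: sub XY Xa|apply: sub YX Yb].
split; first split.
- by apply: (inU X0) => //; case: (FR _ FX0) => -[].
- by case.
- move=> a b Ua Ub; have [X [FX Xa Xb]] := Uin2 _ _ Ua Ub => ab.
  by apply: (inU X) => //; case: (FR _ FX) => -[_ _ + _] _; apply.
- move=> a b Ua Ub; have [X [FX Xa Xb]] := Uin2 _ _ Ua Ub.
  by apply: (inU X) => //; case: (FR _ FX) => -[_ _ _ +] _; apply;
    first exact: Xa.
move=> u v1 v2 Uu U1 U2 vD uv.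
have [X [FX X1 X2]] := Uin2 _ _ U1 U2; have [Y [FY Yu]] := Uin _ Uu.
have [Z [FZ Zu Z1 Z2]] :
    exists Z, [/\ F Z, carrier Z u, carrier Z v1 & carrier Z v2].
  by have [XY|YX] := Ftot _ _ FX FY; [exists Y|exists X]; split=> //;
    [apply: sub XY X1|apply: sub XY X2|apply: sub YX Yu].
have [_ RZ] := FR _ FZ.
have [u1 [u2 [Zu1 Zu2 l1 l2 ue]]] := RZ _ _ _ Zu Z1 Z2 vD uv.
by exists u1, u2; split=> //; apply: inU FZ _.
Qed.

Lemma block_above X : rdp_subalgebra X ->
  exists B : subEffectAlgebra E, block B /\ (X `<=` B)%classic.
Proof.
move=> RX.
have [A [XA [sA rA] Amax]] :=
  Zorn_above RX (fun F F0 FR => rdp_subalgebra_chain F0 FR).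
have [B BE] := subalgebra_of sA.
have BA : B = A :> set E by apply/seteqP; split=> x /BE.
exists B; split; last by rewrite BA.
split; first by apply/sub_rdpE; rewrite BA.
move=> Q /sub_rdpE rQ BQ; rewrite BA; apply: Amax; first by rewrite -BA.
by split=> //; apply: sub_closed_carrier.
Qed.

Hypothesis E_hom : homogeneous E.

Lemma split_closure_rdp (D : word E -> Prop) : (exists P, D P) ->
  (forall P, D P -> unity P) -> directed D ->
  sub_closed_pred (subsum (split_closure D)) /\
  rdp_pred (subsum (split_closure D)).
Proof.
move=> [P DP] uD dD.
have uD' Q := @split_closure_unity _ D Q uD.
have dD' := split_closure_directed E_hom uD dD.
have eD : exists P, split_closure D P by exists P; apply: split_closure_base.
by split; [apply: subsum_sub_closed|apply: subsum_rdp] => //;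
  apply: split_closure_step.
Qed.

Definition word2 a b : word E := Word (fun i : bool => if i then a else b).

Lemma word2_unity a b : a + b = pone E -> unity (word2 a b).
Proof. by rewrite /unity big_bool. Qed.

Lemma word2_subsum (D : word E -> Prop) a b : D (word2 a b) ->
  subsum (split_closure D) a.
Proof.
move=> Dab; exists (word2 a b); split; first exact: split_closure_base.
by exists [set true]; rewrite /wsum big_set1.
Qed.

Lemma in_block (x : E) :
  exists B : subEffectAlgebra E, block B /\ sub_carrier B x.
Proof.
have [b xb] := @compl E (Some x) isT.
have [|||sD rD] := @split_closure_rdp (eq (word2 (Some x) b)).
- by exists (word2 (Some x) b).
- by move=> _ <-; apply: word2_unity.
- move=> _ _ <- <-; exists (word2 (Some x) b).
  by split=> //; apply: refines_refl.
set C := subsum _ in sD rD.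
have CE : carrier (fun y => C (Some y)) = C.
  apply/funext => -[y|] //=; apply/propext; split=> //.
  by case: sD => _ + _ _ => /[apply].
have [|B [bB sub]] := @block_above (fun y => C (Some y)).
  by rewrite /rdp_subalgebra CE.
by exists B; split=> //; apply: sub; apply: word2_subsum (erefl _).
Qed.

(** The splitting closure of all decompositions within [B] yields a sub-effect algebra [Q] with
    Riesz decomposition that contains [B], hence equals it by maximality; subsums of a closed family
    absorb small parts. *)
Lemma block_small (B : subEffectAlgebra E) a b : block B ->
  carrier B a -> b <~ a -> isSome (b + a) -> carrier B b.
Proof.
move=> [/sub_rdpE rB Bmax] Ba ba baD.
have sB := sub_closed_carrier B.
pose D (P : word E) := unity P /\ forall i, carrier B (P i).
have Dword2 c : carrier B c -> exists d, D (word2 c d).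
  move=> Bc; have [_ Bdef _ BB] := sB; have [d cd] := compl (Bdef _ Bc).
  exists d; split=> [|[] //=]; first exact: word2_unity.
  by apply: BB Bc _; rewrite cd; apply: sub_one.
have uD P : D P -> unity P by case.
have eD : exists P, D P by have [d] := Dword2 _ Ba; exists (word2 a d).
have dD : directed D.
  move=> P Q [uP BP] [uQ BQ].
  have [||m [Bm mr mc]] := rdp_refinement sB rB
    (index_enum_uniq (widx P)) (index_enum_uniq (widx Q)) BP BQ.
  - by rewrite uP.
  - by rewrite uP uQ.
  have rP i : P i = \sum_j m i j by apply: mr; rewrite mem_index_enum.
  have rQ j : Q j = \sum_i m i j by apply: mc; rewrite mem_index_enum.
  (* The rows of the matrix [m] sum to [P] and its columns to [Q], so its entries refine both
     words. *)
  pose R := @Word E (widx P * widx Q)%type (fun k => m k.1 k.2).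
  have PR : refines P R.
    exists fst => i; rewrite rP.
    transitivity (\sum_(k : widx P * widx Q | (k.1 == i) && true) m k.1 k.2).
      by rewrite -(pair_big (pred1 i) xpredT (fun i j => m i j)) /= big_pred1_eq.
    by apply: eq_bigl => k; rewrite andbT.
  exists R; split=> //.
    by split=> [|k]; [apply: refines_unity PR uP|apply: Bm].
  exists snd => j; rewrite rQ -(pair_big xpredT (pred1 j) (fun i j => m i j)) /=.
  by apply: eq_bigr => i _; rewrite big_pred1_eq.
have [sD rD] := split_closure_rdp eD uD dD.
have [Q QE] := subalgebra_of sD.
have CQ c : subsum (split_closure D) c <-> carrier Q c.
  case: c => [c|]; first by split=> /QE.
  by split=> //; case: sD => _ + _ _ => /[apply].
have BQ c : carrier B c -> subsum (split_closure D) c.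
  by move=> /Dword2[d]; apply: word2_subsum.
have QB : Q = B :> set E.
  apply: Bmax; last by move=> c Bc; apply/QE/BQ.
  apply/sub_rdpE; suff -> : carrier Q = subsum (split_closure D) by [].
  by apply/funext => c; apply/propext; rewrite CQ.
rewrite -QB; apply/CQ; apply: (subsum_small E_hom) (BQ _ Ba) ba baD.
- by move=> P; apply: split_closure_unity.
- exact: split_closure_step.
Qed.

End Blocks.

(** * Maximal common lower bounds *)

Section MaximalLowerBound.
Variable E : effectAlgebra.
Implicit Types (a b c u v w : pelt E).
Local Open Scope ring_scope.

(** Split [q = e + g] along [x = p + p1]. Removing [e] from [p] and [y] leaves [f] and [Y], both [f]
    and [g] being below [Y]; split [g = g1 + g2] along [Y = f + Y1]. The interpolant [p + g2] adds
    only the part of [g] not already under [f]. *)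
Lemma rdp_interpolation (C : pelt E -> Prop) p q x y :
  sub_closed_pred C -> rdp_pred C -> C p -> C q -> C x -> C y ->
  p <~ x -> p <~ y -> q <~ x -> q <~ y ->
  exists c, [/\ C c, p <~ c, q <~ c, c <~ x & c <~ y].
Proof.
move=> [C1 Cdef CD CB] rC Cp Cq Cx Cy [p1 px] py qx qy.
have Cp1 : C p1 by apply: CB Cp _; rewrite px.
have D1 : isSome (p + p1) by rewrite px; apply: Cdef.
rewrite -px in qx.
have [e [g [Ce Cg [f ef] gp1 qE]]] := rC _ _ _ Cq Cp Cp1 D1 qx.
have Cf : C f by apply: CB Ce _; rewrite ef.
have [Y eY] : e <~ y by apply: ple_trans qy; rewrite qE; apply: ple_addr.
have CY : C Y by apply: CB Ce _; rewrite eY.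
have eYD : isSome (e + Y) by rewrite eY; apply: Cdef.
have [Y1 fY] : f <~ Y by apply: (ple_add2l eYD); rewrite eY ef.
have gY : g <~ Y by apply: (ple_add2l eYD); rewrite eY -qE.
have CY1 : C Y1 by apply: CB Cf _; rewrite fY.
have YD : isSome (f + Y1) by rewrite fY; apply: Cdef.
rewrite -fY in gY.
have [g1 [g2 [Cg1 Cg2 g1f g2Y gE]]] := rC _ _ _ Cg Cf CY1 YD gY.
have cx : p + g2 <~ x.
  rewrite -px; apply: pleD (ple_refl p) _.
  by apply: ple_trans gp1; rewrite gE; apply: ple_addl.
exists (p + g2); split=> //; [|exact: ple_addr| |].
- by apply: CD => //; apply: ple_def cx (Cdef _ Cx).
- rewrite qE gE -ef addrA; apply: pleD (ple_refl g2).
  by apply: pleD (ple_refl e) _.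
- by rewrite -ef -eY -fY -addrA; apply: pleD (ple_refl e) (pleD (ple_refl f) _).
Qed.

Definition atom a : Prop := a <> 0 /\ forall b, b <~ a -> b = 0 \/ b = a.

Lemma archimedean_mulrn (E_arch : archimedean E) a :
  a <> 0 -> exists n, a *+ n = None.
Proof.
case: a => [x|] a0; last by exists 1%N.
have [|n [_ _ nmax]] := E_arch x; first by move=> x0; apply: a0; rewrite x0.
exists n.+1; have E1 : ntimes n.+1 x = (Some x : pelt E) *+ n.+1.
  by rewrite /ntimes oplus_seqE big_nseq iter_addr addr0.
rewrite -E1; apply: contrapT => /(nmax n.+1 isT).
by rewrite ltnn.
Qed.

(** The defined bound [u] makes every finite sum defined, hence [A] orthogonal; the rest passes
    between [NoDup] lists in [E] and [uniq] sequences in [pelt E]. *)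
Lemma Wplus_sum (E_Wplus : condition_Wplus E) (A : pelt E -> Prop) u v :
  isSome u -> isSome v ->
  (forall s, uniq s -> (forall a, a \in s -> A a) ->
    \sum_(a <- s) a <~ u /\ \sum_(a <- s) a <~ v) ->
  exists w, [/\ forall s, uniq s -> (forall a, a \in s -> A a) ->
    \sum_(a <- s) a <~ w, w <~ u & w <~ v].
Proof.
case: u v => [u|] [v|] // _ _ Auv.
pose A' : set E := fun x => A (Some x).
have fwd s : enum_finite_subset A' s ->
    uniq (map Some s : seq (pelt E)) /\
    (forall a, a \in (map Some s : seq (pelt E)) -> A a).
  case=> nd sA; split; last first.
    elim: s {nd} sA => [|x s IH] //= sA a; rewrite inE => /orP[/eqP->|].
      by apply: sA; left.
    by apply: IH => y ys; apply: sA; right.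
  elim: nd {sA} => // x {}s xs _ us /=; rewrite us andbT.
  apply/negP => H; apply: xs; elim: s H {us} => //= y s IH.
  by rewrite inE => /orP[/eqP[->]|/IH]; [left|right].
have bwd (s : seq (pelt E)) : uniq s -> (forall a, a \in s -> A a) ->
    exists s0, s = map Some s0 /\ enum_finite_subset A' s0.
  elim: s => [|a s IH] /=.
    by exists [::]; split=> //; split=> //; apply: List.NoDup_nil.
  move=> /andP[ans us] sA.
  have [s0 [sE [nd s0A]]] :=
    IH us (fun b bs => sA b (mem_behead (s := a :: s) bs)).
  have Aa : A a by apply: sA; rewrite inE eqxx.
  case: a ans sA Aa => [x|] ans sA Aa; last first.
    (* [None] cannot belong to [A]: as a one-term sum it would lie below the defined [u]. *)
    have [] := Auv [:: None] isT; last by rewrite big_seq1 => /ple_def /(_ isT).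
    by move=> b; rewrite inE => /eqP->.
  exists (x :: s0); rewrite sE; split=> //; split=> [|y [<- //|/s0A //]].
  apply: List.NoDup_cons nd => xs0; move/negP: ans; apply; rewrite sE.
  by elim: s0 xs0 {sE s0A} => //= y s0 IH' [->|/IH'];
    rewrite inE ?eqxx // => ->; rewrite orbT.
have sumE s0 : oplus_seq s0 = \sum_(a <- map Some s0 : seq (pelt E)) a.
  by rewrite big_map oplus_seqE.
have Auv' s : enum_finite_subset A' s -> forall z, oplus_seq s = Some z ->
    ea_le z u /\ ea_le z v.
  move=> /fwd[us sA] z sz; have [l1 l2] := Auv _ us sA.
  by rewrite -sumE sz in l1 l2; split; apply/ea_leE.
have [s sA|z [s [sA sz]]|z [s [sA sz]]|w [wub wu wv]] := E_Wplus A' _ u v.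
- have [us sA'] := fwd s sA; have [l1 _] := Auv _ us sA'.
  by have := ple_def l1 isT; rewrite -sumE; case: oplus_seq.
- by have [] := Auv' s sA z sz.
- by have [] := Auv' s sA z sz.
exists (Some w); split; [|exact/ea_leE|exact/ea_leE].
move=> s us sA; have [s0 [sE s0A]] := bwd s us sA.
have [l1 _] := Auv _ us sA.
have := ple_def l1 isT; rewrite sE -sumE; case e : oplus_seq => [z|] // _.
by apply/ea_leE; apply: wub; exists s0.
Qed.

Section Bounds.
Variables (C : pelt E -> Prop) (x y : pelt E).
Hypotheses (E_arch : archimedean E) (E_Wplus : condition_Wplus E).
Hypotheses (sC : sub_closed_pred C) (rC : rdp_pred C) (Cx : C x) (Cy : C y).

Let L a : Prop := a <~ x /\ a <~ y.
Hypothesis LC : forall a, L a -> C a.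

Let Ldef a : L a -> isSome a.
Proof. by case=> /ple_def + _; apply; case: sC => _ + _ _; apply. Qed.

Let Lle a b : a <~ b -> L b -> L a.
Proof. by move=> ab [bx by_]; split; apply: ple_trans ab _. Qed.

Let rdpL u v1 v2 : L (v1 + v2) -> u <~ v1 + v2 ->
  exists u1 u2, [/\ u1 <~ v1, u2 <~ v2 & u = u1 + u2].
Proof.
move=> Lv uv.
have Cu : C u by apply: LC; apply: Lle uv Lv.
have C1 : C v1 by apply: LC; apply: Lle Lv; apply: ple_addr.
have C2 : C v2 by apply: LC; apply: Lle Lv; apply: ple_addl.
by have [u1 [u2 [_ _ l1 l2 ue]]] := rC Cu C1 C2 (Ldef Lv) uv; exists u1, u2.
Qed.

Definition top_multiple t : Prop := exists a n,
  [/\ atom a, L (a *+ n), ~ L (a *+ n.+1) & t = a *+ n].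

Lemma exists_top_multiple a : a <> 0 ->
  exists n, L (a *+ n) /\ ~ L (a *+ n.+1).
Proof.
move=> /(archimedean_mulrn E_arch)[N aN].
have : ~ L (a *+ N) by rewrite aN => /Ldef.
elim: N {aN} => [|N IH] nL; first by case: nL; split; apply: ple0.
by have [LN|/IH//] := pselect (L (a *+ N)); exists N.
Qed.

Lemma atom_le_mulrn a n g : atom a -> L (a *+ n) -> g <~ a *+ n ->
  exists k, g = a *+ k.
Proof.
move=> [a0 aat]; elim: n g => [|n IH] g.
  by move=> _ /ple_eq0 ->; exists 0%N.
rewrite mulrS => Lan /(rdpL Lan)[g1 [g2 [g1a g2a ->]]].
have [|k ->] := IH g2 _ g2a; first by apply: Lle Lan; apply: ple_addl.
by have [->|->] := aat _ g1a;
  [exists k; rewrite add0r|exists k.+1; rewrite mulrS].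
Qed.

Lemma atom_le_sum a (s : seq (pelt E)) : atom a -> L (\sum_(t <- s) t) ->
  a <~ \sum_(t <- s) t -> exists2 t, t \in s & a <~ t.
Proof.
move=> [a0 aat]; elim: s => [|t s IH]; first by rewrite big_nil => _ /ple_eq0.
rewrite big_cons => Ls /(rdpL Ls)[a1 [a2 [a1t a2s aE]]].
have a1a : a1 <~ a by rewrite aE; apply: ple_addr.
have [a10|a1E] := aat _ a1a; last first.
  by exists t; [rewrite inE eqxx|rewrite -a1E].
have [||t' t's at'] := IH; last by exists t' => //; rewrite inE t's orbT.
  by apply: Lle Ls; apply: ple_addl.
by rewrite aE a10 add0r.
Qed.

Lemma top_multiple_unique a m n : L (a *+ m) -> ~ L (a *+ m.+1) ->
  L (a *+ n) -> ~ L (a *+ n.+1) -> m = n.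
Proof.
have H k l : ~ L (a *+ k.+1) -> L (a *+ l) -> (l <= k)%N.
  move=> nk Ll; rewrite leqNgt; apply/negP => kl; apply: nk; apply: Lle Ll.
  by exists (a *+ (l - k.+1)); rewrite -mulrnDr subnKC.
by move=> Lm nm Ln nn; apply/eqP; rewrite eqn_leq !H.
Qed.

(** Interpolation gives a common lower bound [c] above both [t] and the sum over [s]. With [c] equal
    to that sum plus [r], split [t = g1 + g2] along it. If [g1] were nonzero, the atom of [t] would
    lie below some [t'] in [s], hence be the atom of [t'], and equality of largest multiples would
    give [t = t']. So [t] is below [r]. *)
Lemma top_multiple_sum (s : seq (pelt E)) : uniq s ->
  (forall t, t \in s -> top_multiple t) -> L (\sum_(t <- s) t).
Proof.
elim: s => [|t s IH] /=; first by rewrite big_nil; split; apply: ple0.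
move=> /andP[ts us] sM.
have Ls : L (\sum_(r <- s) r).
  by apply: IH us _ => r rs; apply: sM; rewrite inE rs orbT.
have [a [n [aat Ln nLn tE]]] : top_multiple t by apply: sM; rewrite inE eqxx.
have [[tx ty] [sx sy]] := (Ln, Ls); rewrite -tE in tx ty.
have [c [Cc tc sc cx cy]] := rdp_interpolation sC rC (LC (conj tx ty)) (LC Ls)
  Cx Cy tx ty sx sy.
have [r rE] := sc; rewrite -rE in tc.
have Lc : L (\sum_(r <- s) r + r) by rewrite rE; split.
have [g1 [g2 [g1s g2r tgE]]] := rdpL Lc tc.
suff g10 : g1 = 0.
  rewrite big_cons; apply: Lle Lc; rewrite tgE g10 add0r addrC.
  by apply: pleD => //; apply: ple_refl.
have g1t : g1 <~ a *+ n by rewrite -tE tgE; apply: ple_addr.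
have [[|k] g1E] := atom_le_mulrn aat Ln g1t; first by rewrite g1E.
have as_ : a <~ \sum_(r <- s) r.
  by apply: ple_trans g1s; rewrite g1E mulrS; apply: ple_addr.
have [t' t's at'] := atom_le_sum aat Ls as_.
have [b [m [bat Lm nLm t'E]]] : top_multiple t'.
  by apply: sM; rewrite inE t's orbT.
rewrite t'E in at'; have [[|l] aE] := atom_le_mulrn bat Lm at'.
  by case: aat => a0; case: a0.
have ba : a = b.
  have ble : b <~ a by rewrite aE mulrS; apply: ple_addr.
  by case: aat bat => _ /(_ _ ble) [-> [/(_ erefl)]|-> _].
rewrite ba in tE Ln nLn; move/negP: ts; case.
by rewrite tE (top_multiple_unique Ln nLn Lm nLm) -t'E.
Qed.

Lemma exists_maximal_lower_bound :
  exists w, L w /\ forall z, L (w + z) -> z = 0.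
Proof.
(* This property passes to unions of chains because each sum involves finitely many elements. *)
pose good (A : set (pelt E)) := forall s, uniq s -> (forall a, a \in s -> A a) ->
  L (\sum_(a <- s) a).
have [F [A0 FA0] FP Ftot|A [MA gA Amax]] :=
  @Zorn_above _ good top_multiple top_multiple_sum.
  move=> s us sF.
  have [X FX sX] : exists2 X, F X & forall a, a \in s -> X a.
    elim: s {us} sF => [|a s IH] sF; first by exists A0.
    have [X FX sX] := IH (fun b bs => sF b (mem_behead (s := a :: s) bs)).
    have [Y FY Ya] : exists2 Y, F Y & Y a.
      by have [Y ? ?] := sF a (mem_head a s); exists Y.
    have [XY|YX] := Ftot _ _ FX FY.
      by exists Y => // b; rewrite inE => /orP[/eqP->//|/sX/XY].
    by exists X => // b; rewrite inE => /orP[/eqP->|/sX//]; apply: YX.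
  exact: (FP X FX s us sX).
have [_ Cdef _ _] := sC.
have [w [Aw wx wy]] := Wplus_sum E_Wplus (Cdef _ Cx) (Cdef _ Cy) gA.
exists w; split=> // z Lwz; apply: contrapT => z0.
(* Sums avoiding [b] are below [w], so adding [b] stays below [w + z]; maximality of [A] then puts
   [b] in [A]. *)
have Az b : b <~ z -> A b.
  move=> bz; suff <- : (A `|` [set b])%classic = A by right.
  apply: Amax; first by move=> a; left.
  move=> s us sAb; have [bs|bs] := boolP (b \in s); last first.
    by apply: gA => // a ais; case: (sAb a ais) => // ab; rewrite -ab ais in bs.
  apply: Lle Lwz; rewrite (perm_big _ (perm_to_rem bs)) /= big_cons addrC.
  apply: pleD bz; apply: Aw; first exact: rem_uniq.
  move=> a; rewrite mem_rem_uniq // inE => /andP[/eqP ab /sAb[]//].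
(* [w] is above the largest multiple of each atom. *)
have noatom a : atom a -> ~ a <~ z.
  move=> aat az; have [n [Ln nLn]] := exists_top_multiple aat.1.
  apply: (nLn); rewrite mulrSr; apply: Lle Lwz; apply: pleD az.
  have := Aw [:: a *+ n] isT; rewrite big_seq1; apply=> b.
  by rewrite inE => /eqP->; apply: MA; exists a, n.
have below m : m <~ z -> m <> 0 -> exists y0, [/\ y0 <~ m, y0 <> 0 & y0 <> m].
  move=> mz m0; apply: contrapT => H; apply: (noatom m) mz; split=> // b bm.
  apply: contrapT => /not_orP[b0 bm']; apply: H; by exists b.
(* The gap [e] between [m0] and [z] is the common nonzero element for the final contradiction. *)
have [m0 [m0z m00 m0z']] := below z (ple_refl z) z0.
have [e m0e] := m0z.
have e0 : e <> 0 by move=> e0; apply: m0z'; rewrite -m0e e0 addr0.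
have zD : isSome z by apply: defDr (Ldef Lwz).
have mzD m : m <~ z -> isSome m by move=> /ple_def; apply.
(* A strictly decreasing chain below [m0]; the complements in [z] of its members
   are distinct and all lie above [e]. *)
have chain n : exists (t : seq (pelt E)) m, [/\ size t = n, uniq t,
    forall a, a \in t -> a <~ m0, m <> 0 /\ m <~ m0 &
    forall a, a \in t -> ~ a <~ m].
  elim: n => [|n [t [m [st ut tm0 [mn0 mm0] tm]]]].
    by exists [::], m0; split=> //; split=> //; apply: ple_refl.
  have mz := ple_trans mm0 m0z.
  have [y0 [y0m y00 y0m']] := below m mz mn0.
  exists (m :: t), y0; split=> //=.
  - by rewrite st.
  - by rewrite ut andbT; apply/negP => /tm; apply; apply: ple_refl.
  - by move=> a; rewrite inE => /orP[/eqP->|/tm0].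
  - by split=> //; apply: ple_trans mm0.
  - move=> a; rewrite inE => /orP[/eqP->|at_] ay.
      by apply: y0m'; apply: ple_anti => //; apply: mzD.
    by apply: (tm a) => //; apply: ple_trans y0m.
have /choice[star starE] b : exists c, b <~ z -> b + c = z.
  by have [[c bc]|nb] := pselect (b <~ z); [exists c|exists 0].
have [N eN] := archimedean_mulrn E_arch e0.
have [t [_ [st ut tm0 _ _]]] := chain N.
have tz b : b \in t -> b <~ z by move=> /tm0 bm; apply: ple_trans m0z.
have ustar : uniq (map star t).
  rewrite map_inj_in_uniq // => b c /tz/starE bE /tz/starE cE bc.
  apply: (@cancel_def _ (star b)); first by rewrite addrC bE.
  by rewrite [LHS]addrC bE bc addrC cE.
have Lt : L (\sum_(b <- map star t) b).
  apply: gA => // _ /mapP[b /tz bz ->]; apply: Az.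
  by rewrite -(starE b bz); apply: ple_addl.
(* The defined sum of the [N] distinct complements lies above [e *+ N], which is undefined by the
   choice of [N]. *)
have : isSome (e *+ N); last by rewrite eN.
apply: ple_def (Ldef Lt); rewrite big_map -st.
have -> : e *+ size t = \sum_(b <- t) e.
  by rewrite big_const_seq count_predT iter_addr addr0.
rewrite big_seq [X in _ <~ X]big_seq; apply: ple_sum => b bt.
(* [b + r = m0] and [m0 + e = z] make [e + r] the complement of [b] in [z]. *)
have [r rE] := tm0 b bt; exists r.
have ber : b + (e + r) = z by rewrite (addrC e) addrA rE.
by apply: (@cancel_def _ b); rewrite ber ?(starE b (tz b bt)).
Qed.

End Bounds.
End MaximalLowerBound.

(** * Meets and joins in a block *)

Section BlockLattice.
Variables (E : effectAlgebra) (B : subEffectAlgebra E).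
Implicit Types a b c u v w : pelt E.
Local Open Scope ring_scope.

Lemma compl_anti a a' b b' : a + a' = pone E -> b + b' = pone E -> a <~ b ->
  b' <~ a'.
Proof.
move=> aa' bb' [c ac]; exists c; apply: (@cancel_def _ a).
  by rewrite (addrC b') addrA ac bb'.
by rewrite (addrC b') addrA ac bb' aa'.
Qed.

Lemma sub_archimedean : archimedean E -> archimedean (sub_effectAlgebra B).
Proof.
have ntE n (x : sub_effectAlgebra B) :
    omap sval (ntimes n x) = ntimes n (sval x).
  rewrite /ntimes; elim: n => //= n <-.
  by case: (oplus_seq _) => //= t; rewrite sub_oplusE.
have ntN n (x : sub_effectAlgebra B) :
    ntimes n x <> None <-> ntimes n (sval x) <> None.
  by rewrite -ntE; case: (ntimes n x).
move=> E_arch x x0; have [|n [n0 nx nmax]] := E_arch (sval x).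
  by move=> e; apply: x0; apply: sub_sort_inj.
by exists n; split=> // [|m m0 /ntN]; [apply/ntN|apply: nmax].
Qed.

Hypotheses (E_arch : archimedean E) (E_hom : homogeneous E)
  (E_Wplus : condition_Wplus E) (bB : block B).

Lemma block_meet x y : carrier B x -> carrier B y ->
  exists m, [/\ carrier B m, m <~ x, m <~ y &
    forall l, carrier B l -> l <~ x -> l <~ y -> l <~ m].
Proof.
move=> Bx By; have sB := sub_closed_carrier B.
have [B1 Bdef BD BB] := sB.
have rB : rdp_pred (carrier B) by case: bB => /sub_rdpE.
have [x' xx'] := compl (Bdef _ Bx).
have Bx' : carrier B x' by apply: BB Bx _; rewrite xx'.
have [y' yy'] := compl (Bdef _ By).
(* Split [y = c + b] along [x + x' = 1]; then [a] is below [x] and [b] below [x'], so [a + b] is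
   defined. *)
have [||c [b [Bc Bb [a ca] bx' yE]]] := rB _ _ _ By Bx Bx'.
- by rewrite xx'.
- by rewrite xx' -yy'; apply: ple_addr.
have Ba : carrier B a by apply: BB Bc _; rewrite ca.
have abD : isSome (a + b).
  have : a + b <~ x + x' by apply: pleD bx'; rewrite -ca; apply: ple_addl.
  by rewrite xx' => /ple_def; apply.
(* As [l] is below [b], the sum [l + a] is defined, so the block absorbs [l] as a small part of
   [a]. *)
have LB l : l <~ a /\ l <~ b -> carrier B l.
  move=> [la lb]; apply: (block_small E_hom bB Ba la).
  by apply: ple_def abD; rewrite addrC; apply: pleD (ple_refl a) lb.
have [w [[wa wb] wmax]] :=
  exists_maximal_lower_bound E_arch E_Wplus sB rB Ba Bb LB.
have mx : c + w <~ x by rewrite -ca; apply: pleD (ple_refl c) wa.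
have my : c + w <~ y by rewrite yE; apply: pleD (ple_refl c) wb.
have Bm : carrier B (c + w).
  by apply: BD => //; [exact: LB|apply: ple_def mx (Bdef _ Bx)].
exists (c + w); split=> // l Bl lx ly.
(* The interpolant [k] above [c + w] and [l] equals [c + w + z]; maximality of [w] forces [z = 0],
   so [l] is below [c + w]. *)
have [k [Bk [z mz] lk kx ky]] := rdp_interpolation sB rB Bm Bl Bx By mx my lx ly.
suff z0 : z = 0 by rewrite -[c + w]addr0 -z0 mz.
rewrite -mz -addrA in kx ky; apply: wmax; split.
  by rewrite -ca in kx; apply: ple_add2l kx; rewrite ca; apply: Bdef.
by rewrite yE in ky; apply: ple_add2l ky; rewrite -yE; apply: Bdef.
Qed.

(** De Morgan: the join is the complement of the meet of the complements. *)
Lemma block_join x y : carrier B x -> carrier B y ->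
  exists j, [/\ carrier B j, x <~ j, y <~ j &
    forall u, carrier B u -> x <~ u -> y <~ u -> j <~ u].
Proof.
move=> Bx By; have [B1 Bdef BD BB] := sub_closed_carrier B.
have Bcompl a : carrier B a -> exists a', carrier B a' /\ a + a' = pone E.
  move=> Ba; have [a' aa'] := compl (Bdef _ Ba).
  by exists a'; split=> //; apply: BB Ba _; rewrite aa'.
have [x' [Bx' xx']] := Bcompl _ Bx; have [y' [By' yy']] := Bcompl _ By.
have [m [Bm mx my mmax]] := block_meet Bx' By'.
have [j [Bj mj]] := Bcompl _ Bm; exists j; split=> //.
- by apply: compl_anti mj _ mx; rewrite addrC.
- by apply: compl_anti mj _ my; rewrite addrC.
move=> u Bu xu yu; have [u' [Bu' uu']] := Bcompl _ Bu.
have um : u' <~ m by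
  apply: mmax => //; [apply: compl_anti xu|apply: compl_anti yu].
by apply: compl_anti mj um; rewrite addrC.
Qed.

Lemma block_lattice_ordered : lattice_ordered (sub_effectAlgebra B).
Proof.
move=> x y; have Bx : carrier B (Some (sval x)) := svalP x.
have By : carrier B (Some (sval y)) := svalP y; split.
  have [[j|] [Bj xj yj jmin]] // := block_join Bx By.
  exists (exist _ j Bj); split=> [t [->|->]|u ub]; try exact/sub_leE.
  apply/sub_leE; apply: jmin; first exact: (svalP u).
    by apply/sub_leE; apply: ub; left.
  by apply/sub_leE; apply: ub; right.
have [[m|] [Bm mx my mmax]] // := block_meet Bx By.
exists (exist _ m Bm); split=> [t [->|->]|l lb]; try exact/sub_leE.
apply/sub_leE; apply: mmax; first exact: (svalP l).
  by apply/sub_leE; apply: lb; left.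
by apply/sub_leE; apply: lb; right.
Qed.

End BlockLattice.

Local Open Scope classical_set_scope.

Theorem corollary3p14 (E : effectAlgebra)
    (E_arch : archimedean E) (E_hom : homogeneous E)
    (E_Wplus : condition_Wplus E) :
  \bigcup_(B in [set B : subEffectAlgebra E | block B]) (B : set E) = [set: E]
  /\ forall B : subEffectAlgebra E, block B ->
       MV_effect_algebra (sub_effectAlgebra B) /\
       archimedean (sub_effectAlgebra B).
Proof.
split.
  apply/seteqP; split=> // x _.
  by have [B [bB Bx]] := in_block E_hom x; exists B.
move=> B bB; split; last exact: sub_archimedean.
by split; [exact: block_lattice_ordered|exact: (proj1 bB)].
Qed.
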